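(* Assume the map $\theta$ is invertible, and put $\psi_t(y) := \int_X g\circ\varphi_t \, dP_{\theta^{-1}(y)}$ for $t\in T$, $y\in(y_{\min},y_{\max})$. If $t\mapsto\varphi_t(x)$ is continuous on $T$ for $\mu$-a.e. $x\in X$, and $\varphi_t$ is $\mu$-nonsingular for all $t\in T$, then $t\mapsto\psi_t(y)$ is continuous on $T$ for all $y\in(y_{\min},y_{\max})$.
   Context: Setting. $(X,d)$ is a complete separable metric space with its Borel $\sigma$-algebra and $\mu$ is a Borel probability measure on $X$. $g: X\to\mathbb{R}$ is measurable, bounded, and continuous $\mu$-almost everywhere (i.e. its set of discontinuity points is $\mu$-null). $y_{\min}=\inf g(X)$, $y_{\max}=\sup g(X)$, $Y=[y_{\min},y_{\max}]$. $T\subseteq\mathbb{R}$ is a set of times with $0\in T$; for each $t\in T$, $\varphi_t:X\to X$ is measurable and continuous $\mu$-a.e., with $\varphi_0=\mathrm{id}$. $\varphi_t$ is $\mu$-nonsingular if $\mu\circ\varphi_t^{-1}$ is absolutely continuous with respect to $\mu$. Canonical measures. For $\lambda\in\mathbb{R}$, $Z(\lambda)=\int_X e^{\lambda g}\,d\mu$ and $P_\lambda$ is the probability measure with $dP_\lambda = \frac{e^{\lambda g}}{Z(\lambda)}\,d\mu$. The map $\theta:[-\infty,+\infty]\to Y$ is given by $\theta(\lambda)=\int_X g\,dP_\lambda$ for $\lambda\in\mathbb{R}$, $\theta(-\infty)=y_{\min}$, $\theta(+\infty)=y_{\max}$. *)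

(* Defs.v *)
From HB Require Import structures.
From mathcomp Require Import all_boot all_order all_algebra.
From mathcomp Require Import all_classical all_reals all_analysis measurable_realfun.

Set Implicit Arguments.
Unset Strict Implicit.
Unset Printing Implicit Defensive.

Import Order.TTheory GRing.Theory Num.Theory.
Import numFieldNormedType.Exports.

Local Open Scope classical_set_scope.
Local Open Scope ring_scope.

(* Nonemptiness (pointedness) is required by both [completeType] and
   [measurableType]; it is no restriction on a space carrying a probability. *)
#[short(type="completeMetricType")]
HB.structure Definition CompleteMetric (K : numDomainType) :=
  {T of Complete T & Metric K T}.

Definition separable_space (T : topologicalType) :=
  exists2 D : set T, countable D & dense D.

(* The carrier is [T] itself, so that a point of [borel T] is a point of [T]
   and a map [T -> R] is a map [borel T -> R]. *)
Notation borel T := (g_sigma_algebraType (@open T)).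

Section canonical_measure.
Context {d : measure_display} {T : measurableType d} {R : realType}.
Context (mu : {measure set T -> \bar R}) (g : {mfun T >-> R}).

Definition partition_function (l : R) : R := \int[mu]_x expR (l * g x).

Definition canonical_measure (l : R) : set T -> \bar R :=
  fun A => (\int[mu]_(x in A) (expR (l * g x) / partition_function l)%:E)%E.

Let density_ge0 l x : (0 <= (expR (l * g x) / partition_function l)%:E)%E.
Proof.
rewrite lee_fin divr_ge0 ?expR_ge0//.
by apply: Rintegral_ge0 => y _; exact: expR_ge0.
Qed.

Let measurable_expRM l : measurable_fun setT (fun x => expR (l * g x)).
Proof. by apply: measurableT_comp => //; exact: measurable_funM. Qed.

Let canonical0 l : canonical_measure l set0 = 0%E.
Proof. by rewrite /canonical_measure integral_set0. Qed.

Let canonical_ge0 l A : (0 <= canonical_measure l A)%E.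
Proof. by apply: integral_ge0 => x _; exact: density_ge0. Qed.

Let canonical_sigma_additive l : semi_sigma_additive (canonical_measure l).
Proof.
apply: semi_sigma_additive_nng_induced; last exact: density_ge0.
by apply/measurable_EFinP; exact: measurable_funM.
Qed.

HB.instance Definition _ (l : R) := isMeasure.Build d T R (canonical_measure l)
  (canonical0 l) (canonical_ge0 l) (@canonical_sigma_additive l).

(* The values at -oo and +oo are set by convention; the integral is the value
   on the real line. *)
Definition theta (l : \bar R) : R :=
  match l with
  | l'%:E => \int[canonical_measure l']_x g x
  | -oo%E => inf (range g)
  | +oo%E => sup (range g)
  end.

(* A genuine two-sided inverse only where [theta] is injective with the given
   point in its range; elsewhere its value is irrelevant. *)
Definition theta_inv : R -> \bar R := 'pinv_(fun=> 0%E) setT theta.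

(* [fine] is harmless for [inf (range g) < y < sup (range g)]: when [theta] is
   a bijection onto [inf (range g), sup (range g)], it sends -oo and +oo to the
   endpoints, so that [theta_inv y] is a real number. *)
Definition psi (phi : R -> T -> T) (t y : R) : R :=
  \int[canonical_measure (fine (theta_inv y))]_x g (phi t x).

End canonical_measure.

(* [canonical_measure] is a measure for every measurable [g]; boundedness is
   what makes it a probability. *)
Lemma canonical_measure_setT d (T : measurableType d) (R : realType)
    (mu : probability T R) (g : {mfun T >-> R}) (l : R) :
  bounded_fun g -> canonical_measure mu g l [set: T] = 1%E.
Proof.
move=> [M [Mr gM]].
pose B := Num.max M 0 + 1.
have B0 : 0 <= B by rewrite /B addr_ge0 ?ler01// le_max lexx orbT.
have gB x : `|g x| <= B.
  apply: gM => //; rewrite /B (@le_lt_trans _ _ (Num.max M 0)) ?ltrDl ?ltr01//.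
  by rewrite le_max lexx.
have lgB x : `|l * g x| <= `|l| * B by rewrite normrM ler_wpM2l.
have mf : measurable_fun [set: T] (fun x => expR (l * g x)).
  by apply: measurableT_comp => //; exact: measurable_funM.
have muT : (mu [set: T] < +oo)%E by rewrite probability_setT ltry.
have ie : mu.-integrable [set: T] (EFin \o (fun x => expR (l * g x))).
  apply: measurable_bounded_integrable => //.
  exists (expR (`|l| * B)); split; first exact: num_real.
  move=> K eK x _ /=; rewrite ger0_norm ?expR_ge0// (le_trans _ (ltW eK))//.
  by rewrite ler_expR (le_trans (ler_norm _)).
have Z0 : 0 < partition_function mu g l.
  apply: (@lt_le_trans _ _ (\int[mu]_(_ in [set: T]) expR (- (`|l| * B)))).
    by rewrite Rintegral_cst// [X in fine X](@probability_setT _ _ _ mu) mulr1 expR_gt0.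
  apply: le_Rintegral => //.
    exact: finite_measure_integrable_cst.
  by move=> x _; rewrite ler_expR; have := lgB x; rewrite ler_norml => /andP[].
rewrite /canonical_measure.
under eq_integral do rewrite EFinM.
rewrite integralZr// -[X in (X * _)%E]fineK ?integrable_fin_num//.
by rewrite -EFinM divff// gt_eqF.
Qed.

(* Main.v *)
(** For every real [l], [canonical_measure mu g l] is a probability absolutely
    continuous with respect to [mu]. If [N] is the null set of discontinuities
    of [g], nonsingularity of [phi t] makes the preimage of [N] null, so for
    almost every [x] the map [g] is continuous at [phi t x] and hence
    [g (phi s x)] tends to [g (phi t x)] as [s] tends to [t] in [T]. Since [g]
    is bounded, dominated convergence along sequences in [T] concludes. *)

Require Import Defs.
From HB Require Import structures.
From mathcomp Require Import all_boot all_order all_algebra.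
From mathcomp Require Import all_classical all_reals all_analysis measurable_realfun.

Set Implicit Arguments.
Unset Strict Implicit.
Unset Printing Implicit Defensive.

Import Order.TTheory GRing.Theory Num.Theory.
Import numFieldNormedType.Exports.

Local Open Scope classical_set_scope.
Local Open Scope ring_scope.

(** Dominated convergence speaks of sequences only; this passes from them to the filter
    [within A (nbhs a)]. If some neighbourhood [U] of [l] fails, choice picks in each ball of radius
    [1/(n+1)] around [a] a point of [A] sent outside [U], and this sequence contradicts the
    hypothesis. *)
Lemma cvg_within_seq (R : realType) (V : pseudoMetricType R)
    (W : topologicalType) (A : set V) (f : V -> W) (a : V) (l : W) :
  (forall u : nat -> V, (forall n, A (u n)) -> u n @[n --> \oo] --> a ->
    f (u n) @[n --> \oo] --> l) ->
  f x @[x --> within A (nbhs a)] --> l.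
Proof.
move=> fl U lU; apply: contrapT => nU.
have [u uP] : {u : nat -> V & forall n,
    [/\ A (u n), ball a n.+1%:R^-1 (u n) & ~ U (f (u n))]}.
  apply: (@choice _ _ (fun n x => [/\ A x, ball a n.+1%:R^-1 x & ~ U (f x)])).
  move=> n; apply: contrapT => nex; apply: nU.
  apply/nbhs_ballP; exists n.+1%:R^-1; first by rewrite /= invr_gt0.
  by move=> x ax Ax; apply: contrapT => nUfx; apply: nex; exists x; split.
have ua : u n @[n --> \oo] --> a.
  apply/cvg_ballP => e e0; near=> n.
  have [_ + _] := uP n; apply: le_ball.
  by apply: ltW; near: n; exact: near_infty_natSinv_lt (PosNum e0).
have uA n : A (u n) by have [] := uP n.
have [N _ /(_ N (leqnn N))] := fl u uA ua U lU.
by have [_ _] := uP N.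
Unshelve. all: by end_near. Qed.

Lemma null_dominates_ae d (T : measurableType d) (R : realType)
    (mu nu : {measure set T -> \bar R}) (P : T -> Prop) :
  nu `<< mu -> (\forall x \ae mu, P x) -> \forall x \ae nu, P x.
Proof.
move=> /null_content_dominatesP numu [N [mN muN0 PN]].
by exists N; split => //; exact: numu.
Qed.

(** The exceptional set of [P \o f] lies in the preimage of a null set [N], whose measure is the
    pushforward measure of [N]. *)
Lemma ae_comp_nonsingular d (T : measurableType d) (R : realType)
    (mu : {measure set T -> \bar R}) (f : T -> T) (P : T -> Prop) :
  measurable_fun [set: T] f -> pushforward mu f `<< mu ->
  (\forall x \ae mu, P x) -> \forall x \ae mu, P (f x).
Proof.
move=> mf /null_content_dominatesP fmu [N [mN muN0 PN]].
exists (f @^-1` N); split; last by move=> x /= nPfx; exact: PN.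
- by rewrite -[X in measurable X]setTI; exact: mf.
- exact: (fmu N mN muN0).
Qed.

Lemma canonical_measure_dominated d (T : measurableType d) (R : realType)
    (mu : {measure set T -> \bar R}) (g : {mfun T >-> R}) (l : R) :
  canonical_measure mu g l `<< mu.
Proof.
apply/null_content_dominatesP => A mA muA0.
rewrite /canonical_measure null_set_integral//.
apply/measurable_EFinP; apply: measurable_funTS.
apply: measurable_funM => //.
by apply: measurableT_comp => //; exact: measurable_funM.
Qed.

(** The constant [B] dominates, being integrable for a finite measure. The exceptional null set may
    depend on [t], since continuity is checked one point at a time. *)
Lemma within_continuous_Rintegral d (T : measurableType d) (R : realType)
    (P : {measure set T -> \bar R}) (A : set R) (f : R -> T -> R) (B : R) :
  (P [set: T] < +oo)%E ->
  (forall t, A t -> measurable_fun [set: T] (f t)) ->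
  (forall t x, `|f t x| <= B) ->
  (forall t, A t ->
    \forall x \ae P, f s x @[s --> within A (nbhs t)] --> f t x) ->
  {within A, continuous (fun t => \int[P]_x f t x)}.
Proof.
move=> Pfin mf fB fc; apply/subspace_continuousP => t At.
apply: cvg_within_seq => u uA ut.
(* [Rintegral] is [fine] of the extended integral, so convergence in the extended reals to a finite
   limit suffices. *)
apply: fine_cvg; rewrite /=.
have intB : P.-integrable [set: T] (cst B%:E).
  apply: (@measurable_bounded_integrable _ _ _ P (cst B)) => //.
  exists `|B|; split; first exact: num_real.
  by move=> x Bx y _ /=; exact: ltW.
have mfE s : A s -> measurable_fun [set: T] (EFin \o f s).
  by move=> As; apply/measurable_EFinP; exact: mf.
have fcE : {ae P, forall x, setT x ->
    (f (u n) x)%:E @[n --> \oo] --> (f t x)%:E}.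
  apply: filterS (fc t At) => x fx _.
  apply: cvg_EFin; first exact: nearW.
  (* Since every [u n] lies in [A], convergence to [t] is also convergence along the trace
     filter. *)
  have uW : u n @[n --> \oo] --> within A (nbhs t).
    move=> U /= /ut; rewrite /= !nbhs_filterE => uU.
    by apply: (@filterS _ \oo _ _ _ _ uU) => n /= /(_ (uA n)).
  exact: cvg_comp uW fx.
have [intf _ cf] := dominated_convergence measurableT (fun n => mfE _ (uA n))
  (mfE _ At) fcE intB (aeW _ (fun x n _ => fB (u n) x)).
by rewrite /Rintegral fineK//; exact: integrable_fin_num.
Qed.

Theorem theorem3 (R : realType) (X : completeMetricType R)
  (X_separable : separable_space X)
  (mu : probability (borel X) R)
  (g : {mfun borel X >-> R})
  (g_bounded : bounded_fun g)
  (g_continuous : \forall x \ae mu, {for x : X, continuous (g : X -> R)})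
  (T : set R) (T0 : T 0)
  (phi : R -> X -> X)
  (phi_measurable : forall t, T t ->
    measurable_fun [set: borel X] (phi t : borel X -> borel X))
  (phi_continuous : forall t, T t ->
    \forall x \ae mu, {for x : X, continuous (phi t)})
  (phi0 : phi 0 = id)
  (theta_invertible :
    set_bij [set: \bar R] `[inf (range g), sup (range g)] (theta mu g))
  (phi_path_continuous :
    \forall x \ae mu, {within T, continuous (fun t => phi t x)})
  (phi_nonsingular : forall t, T t ->
    pushforward mu (phi t : borel X -> borel X) `<< mu) :
  forall y, y \in `]inf (range g), sup (range g)[ ->
    {within T, continuous (fun t => psi mu g phi t y)}.
Proof.
move=> y _; pose l := fine (theta_inv mu g y).
have [M [Mr gM]] := g_bounded.
(* [bounded_fun] yields a bound on [g] only for constants strictly above [M], hence [M + 1]. *)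
apply: (@within_continuous_Rintegral _ _ _ (canonical_measure mu g l) T
  (fun t x => g (phi t x)) (M + 1)).
- by rewrite [ltLHS]canonical_measure_setT// ltry.
- by move=> t Tt; exact: measurableT_comp (phi_measurable t Tt).
- by move=> t x; apply: gM => //; rewrite ltrDl.
- move=> t Tt; have Pmu := @canonical_measure_dominated _ _ _ mu g l.
  (* The almost-everywhere hypotheses concern [mu]; absolute continuity carries their consequence
     over to the canonical measure. *)
  apply: (null_dominates_ae Pmu).
  have gphi := ae_comp_nonsingular (phi_measurable t Tt) (phi_nonsingular t Tt)
    g_continuous.
  apply: filterS2 gphi phi_path_continuous => x gx /subspace_continuousP px.
  exact: cvg_comp (px t Tt) gx.
Qed.
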